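(* Let $d\ge2$ be a constant, $\phi\ge1$, and $p\in\mathbb{N}\cup\{\infty\}$. For $\phi$-perturbed $L_p$ instances with $n$ points in $[0,1]^d$, the expected approximation ratio of the worst tour that is locally optimal for 2-Opt is $O(\sqrt[d]{\phi})$.
   Context: A $\phi$-perturbed $L_p$ instance with $n$ points: vertices $v_1,\ldots,v_n$ are placed independently in $[0,1]^d$, vertex $v_i$ according to a density $f_i\colon[0,1]^d\to[0,\phi]$, and distances are $L_p$ distances. A tour is locally optimal for 2-Opt if no 2-change strictly decreases its length, where a 2-change replaces two tour edges $\{u_1,u_2\},\{v_1,v_2\}$ (with $u_1,u_2,v_1,v_2$ distinct and in this order along the tour) by $\{u_1,v_1\},\{u_2,v_2\}$. The approximation ratio of a tour is its length divided by the length of a shortest tour. $O$-notation hides constants depending on $d$ and $p$. *)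

(* Defs.v *)
From HB Require Import structures.
From mathcomp Require Import all_boot all_order all_fingroup all_algebra.
From mathcomp Require Import all_classical all_reals all_analysis.

Set Implicit Arguments.
Unset Strict Implicit.
Unset Printing Implicit Defensive.

Import Order.TTheory GRing.Theory Num.Theory.
Import numFieldNormedType.Exports.

Local Open Scope classical_set_scope.
Local Open Scope ring_scope.

Section lebesgue_measure_tuple.
Context {R : realType}.

Definition cons_pair (d : nat) (x : measurableTypeR R * d.-tuple R) : d.+1.-tuple R :=
  [tuple of x.1 :: x.2].

(* Lebesgue measure on R^d = d.-tuple R, whose measurable sets are generated by
   the coordinate projections. *)
Fixpoint lebesgue_tuple (d : nat) : set (d.-tuple R) -> \bar R :=
  match d with
  | 0 => dirac [tuple]
  | d'.+1 => pushforward (lebesgue_measure \x lebesgue_tuple (d := d'))%E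
               (@cons_pair d')
  end.
Arguments lebesgue_tuple : clear implicits.

Lemma measurable_cons_pair d : measurable_fun setT (@cons_pair d).
Proof.
exact: (@measurable_cons _ _ _ R fst d snd).
Qed.

Let pushforward_cons_sigma_finite d
    (m : {sigma_finite_measure set (d.-tuple R) -> \bar R}) :
  sigma_finite setT (pushforward (lebesgue_measure \x m)%E (@cons_pair d)).
Proof.
have /sigma_finiteP[F [TF ndF Foo]] := sigma_finiteT (@lebesgue_measure R).
have /sigma_finiteP[G [TG ndG Goo]] := sigma_finiteT m.
pose g (x : d.+1.-tuple R) : (measurableTypeR R * d.-tuple R)%type :=
  (thead x, [tuple of behead x]).
have gK : cancel (@cons_pair d) g.
  by move=> [x t]; rewrite /g /cons_pair/=; congr pair; apply/val_inj.
have mg : measurable_fun setT g.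
  apply/measurable_fun_pairP; split.
    exact: (@measurable_tnth _ R).
  exact: (@measurable_behead _ R).
exists (fun k => g @^-1` (F k `*` G k)).
  rewrite -preimage_bigcup -[LHS](@preimage_setT _ _ g); congr preimage.
  rewrite -setXTT TF TG predeqE => -[x y]; split.
    move=> [/= [i _ Fix] [k _ Gky]]; exists (maxn i k) => //; split.
    - by move: x Fix; exact/subsetPset/ndF/leq_maxl.
    - by move: y Gky; exact/subsetPset/ndG/leq_maxr.
  by move=> [k _ []/= ? ?]; split; exists k.
move=> k; have [mF Fk] := Foo k; have [mG Gk] := Goo k; split.
  by rewrite -[X in measurable X]setTI; apply: mg => //; exact: measurableX.
rewrite /pushforward -comp_preimage (_ : g \o _ = idfun); last first.
  by apply/funext => x /=; rewrite gK.
by rewrite preimage_id product_measure1E// lte_mul_pinfty// ge0_fin_numE.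
Qed.

Let lebesgue_tuple_struct d :
  {m : {sigma_finite_measure set (d.-tuple R) -> \bar R} |
    m = lebesgue_tuple d :> (_ -> _)}.
Proof.
elim: d => [|d [m mE]] /=; first by exists (dirac [tuple]).
pose pm := pushforward (lebesgue_measure \x m)%E (@cons_pair d).
pose h := @Measure_isSigmaFinite.Build _ _ _ pm
  (pushforward_cons_sigma_finite m).
pose m' : {sigma_finite_measure set (d.+1.-tuple R) -> \bar R} :=
  HB.pack pm (h (@measurable_cons_pair d)).
by exists (m' (@measurable_cons_pair d)); rewrite /= /pm mE.
Qed.

Let lebesgue_tuple0 d : lebesgue_tuple d set0 = 0%E.
Proof. by have [m <-] := lebesgue_tuple_struct d; rewrite measure0. Qed.

Let lebesgue_tuple_ge0 d A : (0 <= lebesgue_tuple d A)%E.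
Proof. by have [m <-] := lebesgue_tuple_struct d; exact: measure_ge0. Qed.

Let lebesgue_tuple_sigma_additive d : semi_sigma_additive (lebesgue_tuple d).
Proof.
by have [m <-] := lebesgue_tuple_struct d; exact: measure_semi_sigma_additive.
Qed.

HB.instance Definition _ d := isMeasure.Build _ _ _ (lebesgue_tuple d)
  (lebesgue_tuple0 d) (@lebesgue_tuple_ge0 d) (@lebesgue_tuple_sigma_additive d).

Let lebesgue_tuple_sigma_finite d : sigma_finite setT (lebesgue_tuple d).
Proof. by have [m <-] := lebesgue_tuple_struct d; exact: sigma_finiteT. Qed.

HB.instance Definition _ d := Measure_isSigmaFinite.Build _ _ _
  (lebesgue_tuple d) (@lebesgue_tuple_sigma_finite d).

Lemma lebesgue_tuple_box d (A : 'I_d -> set R) :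
  (forall k, measurable (A k)) ->
  (lebesgue_tuple d [set x | forall k, A k (tnth x k)] =
   \prod_(k < d) lebesgue_measure (A k))%E.
Proof.
elim: d A => [|d IH] A mA.
  rewrite big_ord0 /= diracE mem_set//= => -[].
  by case.
have mB : measurable [set x : d.-tuple R | forall k, A (lift ord0 k) (tnth x k)].
  rewrite (_ : [set x | _] =
      \bigcap_(k in [set: 'I_d]) ((@tnth d R ^~ k) @^-1` A (lift ord0 k))).
    apply: fin_bigcap_measurable => // k _.
    by rewrite -[X in measurable X]setTI; exact: measurable_tnth.
  by apply/seteqP; split => t /= H k; [move=> _|]; exact: H.
rewrite big_ord_recl -IH // /= /pushforward.
transitivity ((lebesgue_measure \x lebesgue_tuple d)%E
    (A ord0 `*` [set x : d.-tuple R | forall k, A (lift ord0 k) (tnth x k)])).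
  congr (product_measure1 _ _ _); apply/seteqP; split => -[x t] /=.
    move=> H; split; first by have := H ord0.
    by move=> k; have := H (lift ord0 k); rewrite /cons_pair tnthS.
  move=> [H0 H] k; have [j ->|->] := unliftP ord0 k; last by [].
  by rewrite /cons_pair tnthS; exact: H.
by rewrite product_measure1E //; exact: mA.
Qed.

End lebesgue_measure_tuple.
Arguments lebesgue_tuple R d : clear implicits.

Variant Lp_index := Lp_fin of nat | Lp_infty.

Definition Lp_valid (p : Lp_index) : bool :=
  if p is Lp_fin m then (0 < m)%N else true.

Definition Lp_dist (R : realType) (d : nat) (p : Lp_index) (x y : d.-tuple R) : R :=
  match p with
  | Lp_fin m => (\sum_(k < d) `|tnth x k - tnth y k| ^+ m) `^ (m%:R^-1)
  | Lp_infty => \big[Num.max/0]_(k < d) `|tnth x k - tnth y k|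
  end.

Section tours.
Context {R : realType} {d n : nat}.
Variables (p : Lp_index) (v : 'I_n -> d.-tuple R).
Implicit Types (s : 'S_n) (E : {set {set 'I_n}}).

(* A permutation s encodes the tour s 0, s 1, ..., s (n-1), s 0; edges are
   unordered pairs of vertices, and ordS is the cyclic successor on 'I_n. *)
Definition tour_edges s : {set {set 'I_n}} :=
  [set [set s i; s (ordS i)] | i : 'I_n]%SET.

Definition edges_length E : R :=
  \sum_(a < n) \sum_(b < n | (a < b)%N && ([set a; b]%SET \in E))
    Lp_dist p (v a) (v b).

Definition tour_length s : R := edges_length (tour_edges s).

(* With u1 = s i, u2 = s (i+1), v1 = s j, v2 = s (j+1) distinct, these vertices
   occur in this order along the tour, so that the resulting edge set is again
   that of a tour. *)
Definition two_change s (i j : 'I_n) : {set {set 'I_n}} :=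
  ((tour_edges s :\: [set [set s i; s (ordS i)]; [set s j; s (ordS j)]])
   :|: [set [set s i; s j]; [set s (ordS i); s (ordS j)]])%SET.

Definition two_opt_optimal s : bool :=
  [forall i, forall j, uniq [:: s i; s (ordS i); s j; s (ordS j)] ==>
     ~~ (edges_length (two_change s i j) < tour_length s)].

Definition shortest_tour_length : R :=
  \big[Num.min/tour_length 1%g]_(s : 'S_n) tour_length s.

(* As x / 0 = 0, the ratio is 0 if all points coincide. *)
Definition approx_ratio s : R := tour_length s / shortest_tour_length.

(* Ratios are nonnegative and a shortest tour is 2-Opt optimal, so the default
   value 0 of the maximum is harmless. *)
Definition worst_two_opt_ratio : R :=
  \big[Num.max/0]_(s : 'S_n | two_opt_optimal s) approx_ratio s.

End tours.

Definition unit_cube (R : realType) (d : nat) : set (d.-tuple R) :=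
  [set x | forall k, 0 <= tnth x k <= 1].
Arguments unit_cube R d : clear implicits.

Section perturbed_instances.
Local Open Scope ereal_scope.
Context {R : realType} {disp : measure_display} {Omega : measurableType disp}.
Variable P : probability Omega R.

Definition has_cube_density (d : nat) (X : Omega -> d.-tuple R)
    (f : d.-tuple R -> R) : Prop :=
  forall A : set (d.-tuple R), measurable A ->
    P (X @^-1` A) = \int[lebesgue_tuple R d]_(x in A `&` unit_cube R d) (f x)%:E.

Definition mutually_independent (disp' : measure_display)
    (T : measurableType disp') (n : nat) (X : 'I_n -> Omega -> T) : Prop :=
  forall (J : {set 'I_n}) (A : 'I_n -> set T),
    (forall i, measurable (A i)) ->
    P (\bigcap_(i in [set` J]) (X i @^-1` A i)) =
    \prod_(i in J) P (X i @^-1` A i).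

Definition perturbed_instance (phi : R) (d n : nat)
    (f : 'I_n -> d.-tuple R -> R) (X : 'I_n -> {RV P >-> d.-tuple R}) : Prop :=
  [/\ forall i, measurable_fun (unit_cube R d) (f i),
      forall i x, unit_cube R d x -> (0 <= f i x <= phi)%R,
      forall i, has_cube_density (X i) (f i)
    & mutually_independent (fun i => X i : Omega -> d.-tuple R)].

End perturbed_instances.

(* Main.v *)
(* Upper bound. Subdivide the cube into cells of side 2^-k. In a 2-optimal tour,
   two edges of length about d 2^-k cannot agree both in the cell of the tail and
   in the cell of the head, so there are O(2^(dk)) edges of this length. Summing
   over k up to (log2 n) / d bounds the length of the tour by O(n^(1-1/d)).

   Lower bound. Subdivide the cube into cells of side 1/M with M^d of order
   n phi, so that a vertex falls next to a given cell with probability O(1/n).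
   Let S be the set of vertices whose cell touches the cell of a vertex of larger
   index. Exposing the vertices one at a time bounds E[256^|S|] by 2^n, hence
   |S| < n/4 except with probability 2^-n. Each edge shorter than 1/M has an
   endpoint in S, so at least n/2 edges of every tour have length at least 1/M,
   and every tour has length at least n/(2M).

   On the exceptional event the ratio is still at most d n^2. *)
Require Import Defs.
From HB Require Import structures.
From mathcomp Require Import all_boot all_order all_fingroup all_algebra.
From mathcomp Require Import all_classical all_reals all_analysis.
From mathcomp Require Import measurable_realfun.
From mathcomp Require Import zify ring lra.

Import Order.TTheory GRing.Theory Num.Theory.
Import numFieldNormedType.Exports.

Local Open Scope classical_set_scope.
Local Open Scope ring_scope.

(** * Comparison of $L_p$ distances with coordinate differences *)

Section Lp_dist_theory.
Context {R : realType} {d : nat} (p : Lp_index).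
Implicit Types x y : d.-tuple R.

Lemma Lp_dist_sym x y : Lp_dist p x y = Lp_dist p y x.
Proof.
rewrite /Lp_dist; case: p => [m|].
  by congr powR; apply: eq_bigr => k _; rewrite distrC.
by apply: eq_bigr => k _; rewrite distrC.
Qed.

Lemma Lp_dist_ge0 x y : 0 <= Lp_dist p x y.
Proof.
by rewrite /Lp_dist; case: p => [m|]; [exact: powR_ge0|exact: bigmax_ge_id].
Qed.

Lemma expr_root (m : nat) (x : R) :
  (0 < m)%N -> 0 <= x -> (x ^+ m) `^ (m%:R^-1) = x.
Proof.
move=> m0 x0; rewrite -powR_mulrn// -powRrM divff ?powRr1//.
by rewrite pnatr_eq0 -lt0n.
Qed.

Lemma Lp_dist_ge_coord x y k :
  Lp_valid p -> `|tnth x k - tnth y k| <= Lp_dist p x y.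
Proof.
rewrite /Lp_dist; case: p => [m /= m0|_]; last exact: (le_bigmax _ _ k).
rewrite -[leLHS](expr_root m)//; apply: ge0_ler_powR.
- by rewrite invr_ge0.
- by rewrite nnegrE exprn_ge0.
- by rewrite nnegrE; apply: sumr_ge0 => i _; rewrite exprn_ge0.
- rewrite (bigD1 k)//= lerDl; apply: sumr_ge0 => i _.
  by rewrite exprn_ge0.
Qed.

(** In [a i ^+ m * a i] the power is at most the same power of the total, and the remaining factors
    add up to the total. This puts every $L_p$ distance below the $L_1$ distance. *)
Lemma sum_expr_le (I : finType) (a : I -> R) (m : nat) :
  (0 < m)%N -> (forall i, 0 <= a i) ->
  \sum_i a i ^+ m <= (\sum_i a i) ^+ m.
Proof.
case: m => // m _ a0; rewrite exprSr mulr_sumr.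
apply: ler_sum => i _; rewrite exprSr ler_wpM2r//.
apply: lerXn2r; rewrite ?nnegrE ?sumr_ge0//.
by rewrite (bigD1 i)//= lerDl sumr_ge0.
Qed.

Lemma Lp_dist_le_sum x y :
  Lp_valid p -> Lp_dist p x y <= \sum_(k < d) `|tnth x k - tnth y k|.
Proof.
rewrite /Lp_dist; case: p => [m /= m0|_].
  rewrite -[leRHS](expr_root m)// ?sumr_ge0//.
  apply: ge0_ler_powR; rewrite ?nnegrE ?invr_ge0//.
  - by apply: sumr_ge0 => i _; rewrite exprn_ge0.
  - by rewrite exprn_ge0// sumr_ge0.
  - exact: sum_expr_le.
apply: bigmax_le => [|k _]; first exact: sumr_ge0.
by rewrite (bigD1 k)//= lerDl sumr_ge0.
Qed.

Lemma Lp_dist_le_coord x y (r : R) :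
  Lp_valid p -> (forall k, `|tnth x k - tnth y k| <= r) ->
  Lp_dist p x y <= d%:R * r.
Proof.
move=> pv xyr; apply: le_trans (Lp_dist_le_sum _ _ pv) _.
apply: le_trans (ler_sum _ (fun k _ => xyr k)) _.
by rewrite sumr_const card_ord mulr_natl.
Qed.

End Lp_dist_theory.

(** * Tour lengths as sums over edges, and the 2-change inequality *)

Section tour_theory.
Context {R : realType} {d n : nat}.
Variables (p : Lp_index) (v : 'I_n -> d.-tuple R).
Implicit Types (s : 'S_n) (E : {set {set 'I_n}}).

(** At most one pair contributes, so a set that is not a pair of distinct vertices gets weight 0. *)
Definition edge_weight (e : {set 'I_n}) : R :=
  \sum_(a < n) \sum_(b < n | (a < b)%N && ([set a; b]%SET == e))
    Lp_dist p (v a) (v b).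

Lemma edge_weight_ge0 e : 0 <= edge_weight e.
Proof. by do 2 (apply: sumr_ge0 => ? _); exact: Lp_dist_ge0. Qed.

Lemma edge_weight_pair a b :
  a != b -> edge_weight [set a; b]%SET = Lp_dist p (v a) (v b).
Proof.
wlog lab : a b / (a < b)%N.
  move=> H; rewrite neq_ltn => /orP[lab|lba]; apply/esym.
    by rewrite H// neq_ltn lab.
  by rewrite finset.setUC Lp_dist_sym H// neq_ltn lba.
move=> ab; rewrite /edge_weight pair_big_dep/= (big_pred1 (a, b))//= => -[i j] /=.
rewrite xpair_eqE; apply/andP/andP => [[lij /eqP E]|[/eqP-> /eqP->]]; last first.
  by rewrite eqxx.
have := set21 a b; have := set22 a b; rewrite -E !inE => hb ha.
case/orP: ha => /eqP ha; case/orP: hb => /eqP hb; subst; rewrite ?eqxx//.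
  by move: lab; rewrite ltnn.
  by move: lab lij; lia.
by move: lab; rewrite ltnn.
Qed.

Lemma edges_lengthE E : edges_length p v E = \sum_(e in E) edge_weight e.
Proof.
rewrite /edges_length /edge_weight exchange_big/=; apply: eq_bigr => a _.
rewrite (exchange_big_dep (fun b : 'I_n => (a < b)%N))/=; last by move=> ? ? _ /andP[].
rewrite big_mkcondr/=; apply: eq_bigr => b ab.
case: ifPn => abE.
  by rewrite (big_pred1 [set a; b]%SET)// => e; rewrite ab/= eq_sym;
    case: eqP => [->|]; rewrite ?abE// andbF.
by rewrite big1// => e /andP[eE /andP[_ /eqP abe]]; rewrite abe eE in abE.
Qed.

Lemma tour_length_ge0 s : 0 <= tour_length p v s.
Proof.
rewrite /tour_length edges_lengthE sumr_ge0// => e _; exact: edge_weight_ge0.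
Qed.

Lemma edge_weight_le_tour_length s i :
  edge_weight [set s i; s (ordS i)]%SET <= tour_length p v s.
Proof.
rewrite /tour_length edges_lengthE (bigD1 [set s i; s (ordS i)]%SET)/=.
  by rewrite lerDl sumr_ge0// => e _; exact: edge_weight_ge0.
by apply/imsetP; exists i.
Qed.

Lemma ordS_neq (i : 'I_n) : (1 < n)%N -> i != ordS i.
Proof.
move=> n1; apply/eqP => /(congr1 val)/=; have := ltn_ord i.
rewrite leq_eqVlt => /predU1P[Ei|lin]; first by rewrite Ei modnn; lia.
by rewrite modn_small//; lia.
Qed.

Lemma ordSS_neq (i : 'I_n) : (2 < n)%N -> i != ordS (ordS i).
Proof.
move=> n2; apply/eqP => /(congr1 val)/=; have := ltn_ord i.
rewrite leq_eqVlt => /predU1P[Ei|lin].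
  by rewrite Ei modnn modn_small; lia.
rewrite (@modn_small i.+1)//; move: lin; rewrite leq_eqVlt => /predU1P[Ei|lin].
  by rewrite Ei modnn; lia.
by rewrite modn_small//; lia.
Qed.

(** Equal edges at distinct positions would be traversed in opposite directions, giving
    [j = ordS (ordS j)], which is impossible on three or more vertices. *)
Lemma tour_edge_inj s : (2 < n)%N -> injective (fun i => [set s i; s (ordS i)]%SET).
Proof.
move=> n2 i j E.
have := set21 (s i) (s (ordS i)); rewrite E !inE !(inj_eq perm_inj).
case/orP => /eqP// Ei.
have := set22 (s i) (s (ordS i)); rewrite E !inE !(inj_eq perm_inj).
case/orP => /eqP Ej; last by apply: (can_inj (@ordSK _)).
by have := ordSS_neq j n2; rewrite -Ei Ej eqxx.
Qed.

Lemma tour_lengthE s : (2 < n)%N ->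
  tour_length p v s = \sum_i Lp_dist p (v (s i)) (v (s (ordS i))).
Proof.
move=> n2; rewrite /tour_length edges_lengthE /tour_edges big_imset/=; last first.
  by move=> i j _ _; exact: tour_edge_inj.
apply: eq_bigr => i _.
by rewrite edge_weight_pair// (inj_eq perm_inj) ordS_neq// ltnW.
Qed.

Lemma two_opt_optimal_le s i j : (2 < n)%N -> two_opt_optimal p v s ->
  uniq [:: s i; s (ordS i); s j; s (ordS j)] ->
  Lp_dist p (v (s i)) (v (s (ordS i))) + Lp_dist p (v (s j)) (v (s (ordS j)))
  <= Lp_dist p (v (s i)) (v (s j)) + Lp_dist p (v (s (ordS i))) (v (s (ordS j))).
Proof.
move=> n2 /forallP/(_ i)/forallP/(_ j)/implyP opt U; have := opt U.
have {opt}U := U; move: U; rewrite /= !inE !negb_or -!andbA.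
move=> /and5P[n1 n3 n4 n5 /andP[n6 /andP[n7 _]]].
rewrite -leNgt; set e1 := [set s i; s (ordS i)]%SET.
set e2 := [set s j; s (ordS j)]%SET.
set f1 := [set s i; s j]%SET; set f2 := [set s (ordS i); s (ordS j)]%SET.
rewrite /tour_length !edges_lengthE => H.
have e12 : e2 != e1.
  apply/eqP => E; have := set21 (s i) (s (ordS i)); rewrite -/e1 -E !inE.
  by rewrite (negPf n3) (negPf n4).
have e1E : e1 \in tour_edges s by apply/imsetP; exists i.
have e2E : e2 \in tour_edges s by apply/imsetP; exists j.
have {H} := H; rewrite (bigD1 e1)//= (bigD1 e2)/=; last by rewrite e2E.
set S := (X in _ + (_ + X) <= _).
(* An upper bound suffices. It is checked edge by edge and allows the new edges to coincide or to
   lie in the old tour. *)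
have : \sum_(e in two_change s i j) edge_weight e
    <= S + (edge_weight f1 + edge_weight f2).
  have SE : S = \sum_(e in (tour_edges s :\: [set e1; e2])%SET) edge_weight e.
    by apply: eq_bigl => e; rewrite !inE negb_or -andbA andbC.
  rewrite /two_change -/e1 -/e2 -/f1 -/f2 SE big_mkcond [X in _ <= X + _]big_mkcond/=.
  rewrite [X in _ <= X + _](_ : _ = \sum_e (if e \in (tour_edges s :\: [set e1; e2])%SET
    then edge_weight e else 0))//.
  have big1f f : edge_weight f = \sum_e (if e == f then edge_weight e else 0).
    by rewrite -big_mkcond big_pred1_eq.
  rewrite (big1f f1) (big1f f2) -!big_split/=; apply: ler_sum => e _.
  rewrite !inE; have := edge_weight_ge0 e.
  by case: (e == e1); case: (e == e2); case: (e == f1); case: (e == f2);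
    case: (e \in tour_edges s) => /=; lra.
rewrite !edge_weight_pair//; lra.
Qed.

End tour_theory.

(** * A priori bound on the ratio *)

Section tour_ratio.
Context {R : realType} {d n : nat}.
Variables (p : Lp_index) (v : 'I_n -> d.-tuple R).
Implicit Types s : 'S_n.

(** The case [a = b] is the loop of a tour on a single vertex, which has weight 0. *)
Lemma edge_weight_le_dist a b :
  edge_weight p v [set a; b]%SET <= Lp_dist p (v a) (v b).
Proof.
have [->|ab] := eqVneq a b; last by rewrite edge_weight_pair.
rewrite /edge_weight big1 ?Lp_dist_ge0// => i _; rewrite big1// => j.
move=> /andP[lij /eqP E].
have := set21 i j; have := set22 i j; rewrite E !inE !orbb => /eqP jb /eqP ib.
by move: lij; rewrite ib jb ltnn.
Qed.

(* The triangle inequality is used on each coordinate, so that Minkowski's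
   inequality is avoided at the price of a factor [d] in the next lemma. *)
Lemma coord_dist_le_tour_length s a b k : Lp_valid p ->
  `|tnth (v a) k - tnth (v b) k| <= n%:R * tour_length p v s.
Proof.
move=> pv; set L := tour_length p v s.
have L0 : 0 <= L by exact: tour_length_ge0.
pose x i := tnth (v (s i)) k.
have step i : `|x i - x (ordS i)| <= L.
  have [iS|iS] := eqVneq i (ordS i); first by rewrite -iS subrr normr0.
  apply: le_trans (edge_weight_le_tour_length p v s i).
  by rewrite edge_weight_pair ?(inj_eq perm_inj)//; exact: Lp_dist_ge_coord.
(* The walk follows increasing positions and never passes from the last one to the first. *)
have walk m (i j : 'I_n) : j = (i + m)%N :> nat -> `|x i - x j| <= m%:R * L.
  elim: m j => [|m IH] j ij.
    by rewrite (_ : j = i) ?subrr ?normr0 ?mul0r//; apply: val_inj; rewrite /= ij addn0.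
  have lm : (i + m < n)%N by have := ltn_ord j; lia.
  have jS : j = ordS (Ordinal lm).
    by apply: val_inj; rewrite /= modn_small; have := ltn_ord j; lia.
  rewrite -natr1 mulrDl mul1r; apply: le_trans (ler_distD (x (Ordinal lm)) _ _) _.
  by rewrite lerD ?IH// jS.
rewrite -(permKV s a) -(permKV s b) -/(x _) -/(x _).
move: (s^-1 a)%g (s^-1 b)%g => i j.
wlog ij : i j / (i <= j)%N.
  by move=> H; have [/H//|/ltnW/H] := leqP i j; rewrite distrC.
apply: le_trans (walk (j - i)%N _ _ _) _; first by rewrite subnKC.
by rewrite ler_wpM2r// ler_nat; have := ltn_ord j; lia.
Qed.

Lemma tour_length_le_tour_length s s' : Lp_valid p ->
  tour_length p v s <= d%:R * n%:R ^+ 2 * tour_length p v s'.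
Proof.
move=> pv; rewrite {1}/tour_length edges_lengthE.
set L := tour_length p v s'.
have wL e : e \in tour_edges s -> edge_weight p v e <= d%:R * (n%:R * L).
  case/imsetP => i _ ->; apply: le_trans (edge_weight_le_dist _ _) _.
  by apply: Lp_dist_le_coord => // k; exact: coord_dist_le_tour_length.
apply: le_trans (ler_sum _ wL) _.
rewrite sumr_const -[leLHS]mulr_natl.
rewrite [leRHS](_ : _ = n%:R * (d%:R * (n%:R * L))); last by ring.
rewrite ler_wpM2r ?mulr_ge0 ?tour_length_ge0// ler_nat.
by apply: leq_trans (leq_imset_card _ _) _; rewrite card_ord.
Qed.

Lemma shortest_tourP : exists s, shortest_tour_length p v = tour_length p v s.
Proof.
rewrite /shortest_tour_length.
apply: (big_ind (fun x => exists s, x = tour_length p v s)).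
- by exists 1%g.
- by move=> x y [s ->] [s' ->]; rewrite minEle; case: ifP => _; [exists s|exists s'].
- by move=> s _; exists s.
Qed.

Lemma worst_two_opt_ratio_ge0 : 0 <= worst_two_opt_ratio p v.
Proof. exact: bigmax_ge_id. Qed.

Lemma worst_two_opt_ratio_le (r : R) : 0 <= r ->
  (forall s s', two_opt_optimal p v s ->
     tour_length p v s <= r * tour_length p v s') ->
  worst_two_opt_ratio p v <= r.
Proof.
move=> r0 H; apply: bigmax_le => // s opts; rewrite /approx_ratio.
have [s' ->] := shortest_tourP.
(* Division by a zero length yields ratio 0. *)
have [->|L0] := eqVneq (tour_length p v s') 0; first by rewrite invr0 mulr0.
by rewrite ler_pdivrMr ?H// lt_neqAle eq_sym L0 tour_length_ge0.
Qed.

Lemma worst_two_opt_ratio_trivial : Lp_valid p ->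
  worst_two_opt_ratio p v <= d%:R * n%:R ^+ 2.
Proof.
move=> pv; apply: worst_two_opt_ratio_le => [|s s' _].
  by rewrite mulr_ge0// exprn_ge0.
exact: tour_length_le_tour_length.
Qed.

End tour_ratio.

(** * Grid cells of side [1 / m] *)

Section grid.
Context {R : realType} {d : nat}.
Implicit Types x y : d.-tuple R.

(** There are [m.+1] indices per coordinate because a coordinate equal to 1 gets the index [m]. *)
Definition grid_cell (m : nat) x : {ffun 'I_d -> 'I_m.+1} :=
  [ffun k => inord (Num.trunc (m%:R * tnth x k))].

Lemma grid_cell_itv m x k : unit_cube R d x ->
  (grid_cell m x k)%:R <= m%:R * tnth x k < (grid_cell m x k).+1%:R.
Proof.
move=> /(_ k)/andP[x0 x1]; have mx0 : 0 <= m%:R * tnth x k by rewrite mulr_ge0.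
rewrite ffunE inordK ?truncn_itv// ltnS truncn_le_nat.
by rewrite (le_lt_trans (ler_piMr _ x1))// ltr_nat.
Qed.

Definition near_cells (m r : nat) (c c' : {ffun 'I_d -> 'I_m.+1}) : bool :=
  [forall k, (c k <= c' k + r)%N && (c' k <= c k + r)%N].

Lemma near_cells_sym m r (c c' : {ffun 'I_d -> 'I_m.+1}) :
  near_cells m r c c' = near_cells m r c' c.
Proof. by apply: eq_forallb => k; rewrite andbC. Qed.

(** The offsets [c' k + r - c k] range over 0 to [2r] and determine [c']; nearness keeps the
    subtraction from being truncated. *)
Lemma card_near_cells m r (c : {ffun 'I_d -> 'I_m.+1}) :
  (#|[set c' | near_cells m r c c']%SET| <= r.*2.+1 ^ d)%N.
Proof.
pose h (c' : {ffun 'I_d -> 'I_m.+1}) : {ffun 'I_d -> 'I_(r.*2.+1)} :=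
  [ffun k => inord (c' k + r - c k)].
rewrite -(@card_in_imset _ _ h).
  by apply: leq_trans (max_card _) _; rewrite card_ffun !card_ord.
move=> c1 c2; rewrite !inE => /forallP H1 /forallP H2 /ffunP E.
apply/ffunP => k; apply: val_inj; move: (E k) (H1 k) (H2 k); rewrite !ffunE.
move=> /(congr1 val)/= + /andP[a1 a2] /andP[b1 b2].
by rewrite !inordK; lia.
Qed.

Lemma near_grid_cell m r x y : unit_cube R d x -> unit_cube R d y ->
  (forall k, m%:R * `|tnth x k - tnth y k| <= r%:R) ->
  near_cells m r (grid_cell m x) (grid_cell m y).
Proof.
move=> Cx Cy xy; apply/forallP => k.
have := xy k; rewrite -[m%:R](@ger0_norm _ m%:R)// -normrM mulrBr ler_norml.
move=> /andP[]; move: (grid_cell_itv m _ k Cx) (grid_cell_itv m _ k Cy).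
move=> /andP[a1 a2] /andP[b1 b2] c1 c2.
rewrite -natr1 in a2; rewrite -natr1 in b2.
by apply/andP; split; rewrite -ltnS -(ltr_nat R) -natr1 natrD; lra.
Qed.

Lemma same_grid_cell_dist p m x y : Lp_valid p ->
  unit_cube R d x -> unit_cube R d y -> grid_cell m x = grid_cell m y ->
  m%:R * Lp_dist p x y <= d%:R.
Proof.
move=> pv Cx Cy E; case: m E => [|m] E; first by rewrite mul0r.
rewrite mulrC -ler_pdivlMr//; apply: Lp_dist_le_coord => // k.
rewrite -div1r ler_pdivlMr// mulrC -[m.+1%:R](@ger0_norm _ m.+1%:R)//.
rewrite -normrM mulrBr ler_norml.
move: (grid_cell_itv m.+1 _ k Cx) (grid_cell_itv m.+1 _ k Cy); rewrite E.
by rewrite -[X in _ < X]natr1 => /andP[a1 a2] /andP[b1 b2]; lra.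
Qed.

End grid.
Arguments near_cells {d m} r c c'.

(** * Counting the edges of one length scale in a 2-optimal tour *)

Section two_opt_upper_bound.
Context {R : realType} {d n : nat}.
Variables (p : Lp_index) (v : 'I_n -> d.-tuple R) (s : 'S_n).
Hypothesis pv : Lp_valid p.
Hypothesis cube_v : forall i, unit_cube R d (v i).
Hypothesis n_gt2 : (2 < n)%N.
Hypothesis opt_s : two_opt_optimal p v s.

Let len i := Lp_dist p (v (s i)) (v (s (ordS i))).

(* Two edges with the same cells of tails and of heads could be exchanged
   profitably. *)
Lemma card_edges_of_scale m :
  (#|[set i | (d%:R < m%:R * len i <= d.*2%:R)%R]%SET|
     <= m.+1 ^ d * d.*2.*2.+1 ^ d)%N.
Proof.
pose h i := (grid_cell m (v (s i)), grid_cell m (v (s (ordS i)))).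
have n1 : (1 < n)%N by exact: ltnW.
rewrite -(@card_in_imset _ _ h).
  (* The tail has [m.+1 ^ d] possible cells; given its cell, the head has at most
     [d.*2.*2.+1 ^ d]. *)
  apply: (@leq_trans #|[set q : {ffun 'I_d -> 'I_m.+1} * {ffun 'I_d -> 'I_m.+1} |
      near_cells d.*2 q.1 q.2]%SET|).
    apply: subset_leq_card; apply/fintype.subsetP => q /imsetP[i].
    rewrite !inE => /andP[_ li] ->; apply: near_grid_cell => // k.
    by apply: le_trans li; rewrite ler_wpM2l// Lp_dist_ge_coord.
  rewrite cardsE -sum1_card.
  rewrite -(pair_big_dep predT (fun c c' => near_cells d.*2 c c') (fun _ _ => 1%N)).
  apply: (@leq_trans (\sum_(c : {ffun 'I_d -> 'I_m.+1}) d.*2.*2.+1 ^ d)).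
    apply: leq_sum => c _; rewrite sum1_card -cardsE.
    exact: card_near_cells.
  by rewrite sum_nat_const card_ffun !card_ord.
move=> i j; rewrite !inE => /andP[li _] /andP[lj _] [E1 E2].
have D1 := same_grid_cell_dist p m _ _ pv (cube_v _) (cube_v _) E1.
have D2 := same_grid_cell_dist p m _ _ pv (cube_v _) (cube_v _) E2.
apply/eqP/negP => /negP ij.
(* If the edges were consecutive, one of them would join [s i] and [s j], which share a cell and are
   too close for its length. *)
have iSj : i != ordS j.
  by apply/eqP => iE; move: D1 lj; rewrite /len -iE Lp_dist_sym; lra.
have Sij : ordS i != j.
  by apply/eqP => iE; move: D1 li; rewrite /len iE; lra.
have := two_opt_optimal_le p v s i j n_gt2 opt_s.
have -> : uniq [:: s i; s (ordS i); s j; s (ordS j)].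
  rewrite /= !inE !negb_or !(inj_eq perm_inj) (inj_eq (can_inj (@ordSK _))).
  by rewrite !ordS_neq// ij iSj Sij.
move=> /(_ isT); rewrite -/(len i) -/(len j) => H.
(* Both exchanged edges stay inside a cell, so optimality contradicts the lower bounds on [len i]
   and [len j]. *)
have : m%:R * (len i + len j) <= d%:R + d%:R.
  apply: le_trans (lerD D1 D2); rewrite -mulrDr ler_wpM2l//.
by rewrite mulrDr; lra.
Qed.

End two_opt_upper_bound.

(** * Dyadic summation of the edge lengths *)

Section dyadic.
Context {R : realType}.

(** If [a] exceeds [D / 2 ^+ K], it lies in a dyadic band whose upper end [2 * D / 2 ^+ k.+1] is a
    term of the sum and already dominates [a]. *)
Lemma le_dyadic_sum (D a : R) (K : nat) : 0 <= D -> a <= D ->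
  a <= D / 2 ^+ K
     + \sum_(k < K | D < 2 ^+ k.+1 * a <= 2 * D) 2 * D / 2 ^+ k.+1.
Proof.
move=> D0 aD.
have S0 K' : 0 <= \sum_(k < K' | D < 2 ^+ k.+1 * a <= 2 * D) 2 * D / 2 ^+ k.+1.
  by apply: sumr_ge0 => k _; rewrite divr_ge0 ?mulr_ge0 ?exprn_ge0.
suff [H|H] : a <= D / 2 ^+ K \/
    a <= \sum_(k < K | D < 2 ^+ k.+1 * a <= 2 * D) 2 * D / 2 ^+ k.+1.
- by rewrite (le_trans H)// lerDl.
- by rewrite (le_trans H)// lerDr divr_ge0 ?exprn_ge0.
elim: K => [|K [IH|IH]]; first by left; rewrite expr0 divr1.
  have [H|H] := leP (2 ^+ K.+1 * a) D.
    by left; rewrite ler_pdivlMr ?exprn_gt0// mulrC.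
  right; rewrite big_mkcond big_ord_recr/= -big_mkcond/=.
  rewrite H/= (_ : 2 ^+ K.+1 * a <= 2 * D); last first.
    by rewrite exprS -mulrA ler_pM2l// mulrC -ler_pdivlMr// exprn_gt0.
  apply: (le_trans IH); rewrite (_ : D / 2 ^+ K = 2 * D / 2 ^+ K.+1) ?lerDr ?S0//.
  by rewrite exprS invfM mulrACA divff ?mul1r// pnatr_eq0.
right; apply: le_trans IH _; rewrite [leRHS]big_mkcond big_ord_recr/= -big_mkcond/=.
by rewrite lerDl; case: ifP => // _; rewrite divr_ge0 ?mulr_ge0 ?exprn_ge0.
Qed.

Lemma sum_geometric_le (q : R) K : 2 <= q ->
  \sum_(k < K) q ^+ k.+1 <= 2 * q ^+ K.
Proof.
move=> q2; have q0 : 0 <= q by lra.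
elim: K => [|K IH]; first by rewrite big_ord0; lra.
rewrite big_ord_recr/=; have : 2 * q ^+ K <= q ^+ K.+1.
  by rewrite exprS ler_wpM2r// exprn_ge0.
by move: IH; lra.
Qed.

End dyadic.

(** Edges below [d / 2 ^ K] cost at most [n * d / 2 ^ K] together. Band [k] costs its cardinality
    times its upper end, which is of order [2 ^ ((d - 1) * (k + 1))]; the last band dominates this
    geometric series. *)
Lemma two_opt_tour_length_le {R : realType} {d n : nat} (p : Lp_index)
    (v : 'I_n -> d.-tuple R) (s : 'S_n) (K : nat) :
  Lp_valid p -> (forall i, unit_cube R d (v i)) -> (2 < n)%N -> (1 < d)%N ->
  two_opt_optimal p v s -> (2 ^ (d * K) <= n)%N ->
  2 ^+ K * tour_length p v s
    <= (d + 4 * d * (2 * d.*2.*2.+1) ^ d)%:R * n%:R.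
Proof.
move=> pv Cv n2 d1 opts Kn; rewrite tour_lengthE//.
(* The factor 2 absorbs [m.+1 <= 2 * m] for [m = 2 ^ k.+1]. *)
set B := ((2 * d.*2.*2.+1) ^ d)%N.
pose len i := Lp_dist p (v (s i)) (v (s (ordS i))).
have len_le i : len i <= d%:R.
  rewrite -[leRHS]mulr1; apply: Lp_dist_le_coord => // k.
  have /andP[? ?] := Cv (s i) k; have /andP[? ?] := Cv (s (ordS i)) k.
  by rewrite ler_norml; apply/andP; split; lra.
have D0 : 0 <= d%:R :> R by [].
have K0 : 0 < 2 ^+ K :> R by rewrite exprn_gt0.
pose A k := [set i | d%:R < (2 ^ k.+1)%:R * len i <= d.*2%:R]%SET.
have : \sum_i len i <= \sum_(i < n) (d%:R / 2 ^+ K) +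
    \sum_(k < K) \sum_(i in A k) 2 * d%:R / 2 ^+ k.+1.
  apply: le_trans (ler_sum _ (fun i _ => le_dyadic_sum d%:R (len i) K D0 (len_le i))) _.
  rewrite big_split/= lerD2l (exchange_big_dep predT)//=.
  apply: ler_sum => k _; rewrite le_eqVlt; apply/orP; left; apply/eqP.
  by apply: eq_bigl => i; rewrite !inE natrX -mul2n natrM.
have cardA k : #|A k|%:R <= B%:R * (2 ^+ k.+1) ^+ d :> R.
  rewrite -!natrX -natrM ler_nat.
  apply: leq_trans (card_edges_of_scale p v s pv Cv n2 opts _) _.
  rewrite /B -!expnMn leq_exp2r ?(ltnW d1)// mulnAC leq_mul2r; apply/orP; right.
  by rewrite mul2n -addnn -addn1 leq_add2l expn_gt0.
have termA k : \sum_(i in A k) 2 * d%:R / 2 ^+ k.+1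
    <= 2 * d%:R * B%:R * (2 ^+ d.-1) ^+ k.+1 :> R.
  rewrite sumr_const -[leLHS]mulr_natr.
  have := ler_wpM2l _ (cardA k); move=> /(_ (2 * d%:R / 2 ^+ k.+1)).
  move=> /(_ _)/le_trans; apply; first by rewrite divr_ge0 ?mulr_ge0 ?exprn_ge0.
  have -> : (2 ^+ k.+1) ^+ d = 2 ^+ k.+1 * (2 ^+ d.-1) ^+ k.+1 :> R.
    by rewrite [in RHS]exprAC -exprS prednK// ltnW.
  have : (2 ^+ k.+1 : R) != 0 by rewrite expf_neq0.
  move: (2 ^+ k.+1) ((2 ^+ d.-1) ^+ k.+1) => x y x0.
  by rewrite le_eqVlt; apply/orP; left; apply/eqP; field.
rewrite sumr_const card_ord -[X in _ <= X + _]mulr_natr => /le_trans H.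
(* Here [d >= 2] enters: in dimension 1 the series would have ratio 1 and cost a factor [K]. *)
have q2 : 2 <= 2 ^+ d.-1 :> R.
  by rewrite -{1}[2]expr1 ler_eXn2l ?ltr1n//; lia.
have : \sum_i len i <= d%:R / 2 ^+ K * n%:R
     + 2 * d%:R * B%:R * (2 * (2 ^+ d.-1) ^+ K).
  apply: H; rewrite lerD2l.
  apply: (@le_trans _ _ (\sum_(k < K) 2 * d%:R * B%:R * (2 ^+ d.-1) ^+ k.+1)).
    by apply: ler_sum => k _; exact: termA.
  rewrite -mulr_sumr ler_wpM2l ?mulr_ge0//.
  exact: sum_geometric_le.
move=> {}H; rewrite mulrC -ler_pdivlMr//; apply: le_trans H _.
(* The choice of [K] bounds the last band by [n / 2 ^ K], the order of the short edges. *)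
have : (2 ^+ d.-1) ^+ K * 2 ^+ K <= n%:R :> R.
  by rewrite -exprMn -exprSr prednK ?(ltnW d1)// -exprM -natrX ler_nat.
rewrite -ler_pdivlMr// => H.
rewrite natrD !natrM (_ : _ * n%:R / _ = d%:R / 2 ^+ K * n%:R +
  4 * d%:R * B%:R * (n%:R / 2 ^+ K)); last by ring.
rewrite lerD2l.
have := ler_wpM2l _ H; move=> /(_ (4 * d%:R * B%:R)).
rewrite !mulr_ge0// => /(_ isT).
by move: (_ ^+ K) (n%:R / _) => a b; lra.
Qed.

(** * Lower bound for arbitrary tours *)

Section later_neighbours.
Context {T : Type} (e : rel T).

(** Each entry looks only at later ones, so prepending an entry adds at most 1 and leaves the rest
    of the count unchanged. The induction on the exponential moment relies on this. *)
Fixpoint later_count (s : seq T) : nat :=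
  if s is c :: s' then (has (e c) s' + later_count s')%N else 0.

Lemma later_countE (x0 : T) (s : seq T) :
  later_count s = (\sum_(i < size s) has (e (nth x0 s i)) (drop i.+1 s))%N.
Proof.
elim: s => [|c s IH] /=; first by rewrite big_ord0.
by rewrite big_ord_recl/= drop0 IH.
Qed.

Lemma card_later_le n (g : 'I_n -> T) :
  (#|[set i : 'I_n | [exists j : 'I_n, (i < j) && e (g i) (g j)]]%SET|
     <= later_count [tuple g i | i < n])%N.
Proof.
case: n g => [|n] g.
  by rewrite (_ : finset _ = finset.set0) ?cards0//; apply/setP => -[].
rewrite (later_countE (g ord0)) size_tuple -sum1_card big_mkcond/=.
apply: leq_sum => i _; rewrite inE; case: ifP => // /existsP[j /andP[ij eij]].
rewrite lt0b; apply/(has_nthP (g ord0)); exists (j - i.+1)%N.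
  by rewrite size_drop size_tuple card_ord; have := ltn_ord j; lia.
by rewrite nth_drop subnKC// !(nth_map ord0) -?enumT ?size_enum_ord// !nth_ord_enum.
Qed.

End later_neighbours.

Lemma tour_length_ge {R : realType} {d n : nat} (p : Lp_index)
    (v : 'I_n -> d.-tuple R) (s : 'S_n) (m : nat) :
  Lp_valid p -> (forall i, unit_cube R d (v i)) -> (2 < n)%N ->
  (4 * later_count (near_cells 1) [tuple grid_cell m (v i) | i < n] < n)%N ->
  n%:R <= 2 * (m%:R * tour_length p v s).
Proof.
move=> pv Cv n2 few; rewrite tour_lengthE//.
pose g i := grid_cell m (v i).
pose S := [set i : 'I_n | [exists j : 'I_n, (i < j)%N && near_cells 1 (g i) (g j)]]%SET.
have cS : (4 * #|S| < n)%N.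
  apply: leq_ltn_trans few; rewrite leq_mul2l/=; exact: (card_later_le _ _ g).
have sumS (h : 'I_n -> 'I_n) : injective h -> (\sum_i (h i \in S : nat))%N = #|S|.
  move=> hi; rewrite -sum1_card [RHS]big_mkcond/= [RHS](reindex_inj hi).
  by apply: eq_bigr => i _; case: (h i \in S).
(* Each vertex is the tail of one edge and the head of one, so summing this over the tour loses only
   [2 * #|S|], at most [n / 2]. *)
have far i : 1 - ((s i \in S)%:R + (s (ordS i) \in S)%:R)
    <= m%:R * Lp_dist p (v (s i)) (v (s (ordS i))).
  case/boolP: (near_cells 1 (g (s i)) (g (s (ordS i)))) => [ni|fi].
    apply: (@le_trans _ _ 0); last by rewrite mulr_ge0// Lp_dist_ge0.
    have : s i != s (ordS i) by rewrite (inj_eq perm_inj) ordS_neq// ltnW.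
    rewrite neq_ltn => /orP[l|l].
      have -> : s i \in S by rewrite inE; apply/existsP; exists (s (ordS i)); rewrite l.
      by case: (_ \in S) => /=; lra.
    have -> : s (ordS i) \in S.
      by rewrite inE; apply/existsP; exists (s i); rewrite l near_cells_sym.
    by case: (_ \in S) => /=; lra.
  apply: (@le_trans _ _ 1); first by rewrite gerBl addr_ge0.
  rewrite leNgt; apply: contra fi => H; apply: near_grid_cell => // k.
  apply: le_trans (ltW H); rewrite ler_wpM2l//; exact: Lp_dist_ge_coord.
have := ler_sum (index_enum 'I_n) (fun i (_ : true) => far i); rewrite -mulr_sumr.
rewrite big_split/= sumr_const card_ord sumrN big_split/= -!natr_sum.
rewrite (sumS s); last exact: perm_inj.
rewrite (sumS (fun i => s (ordS i))); last first.
  by move=> i j /perm_inj; apply: (can_inj (@ordSK _)).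
have : 4 * #|S|%:R <= n%:R :> R by rewrite -natrM ler_nat ltnW.
by lra.
Qed.

(** * Exponential moment of the number of later neighbours *)

Section tuple_sums.
Context {R : realType} {T : finType}.

Lemma big_tuple_cons n (F : n.+1.-tuple T -> R) :
  \sum_(t : n.+1.-tuple T) F t = \sum_(t : n.-tuple T) \sum_(c : T) F [tuple of c :: t].
Proof.
rewrite exchange_big pair_big/=.
rewrite (reindex (fun q : T * n.-tuple T => [tuple of q.1 :: q.2]))//=.
exists (fun t : n.+1.-tuple T => (thead t, [tuple of behead t])).
  by move=> [c t] _ /=; congr pair; apply: val_inj.
by move=> t _; rewrite [RHS]tuple_eta; apply: val_inj.
Qed.

Lemma prod_tuple_cons n (q : 'I_n.+1 -> T -> R) c (t : n.-tuple T) :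
  \prod_(i < n.+1) q i (tnth [tuple of c :: t] i)
  = q ord0 c * \prod_(i < n) q (lift ord0 i) (tnth t i).
Proof.
by rewrite big_ord_recl; congr (_ * _); apply: eq_bigr => i _; rewrite tnthS.
Qed.

(* Conditionally on the later entries, the head of a random tuple is a
   neighbour of one of them with probability at most [n * eps]. *)
Lemma moment_later_count (e : rel T) (q : nat -> T -> R) (B eps : R) (N : nat) :
  0 <= B -> 0 <= eps ->
  (forall i c, 0 <= q i c) -> (forall i, \sum_c q i c <= 1) ->
  (forall i c', \sum_(c | e c c') q i c <= eps) ->
  forall n, (n <= N)%N -> forall j : nat,
  \sum_(t : n.-tuple T) (\prod_(i < n) q (j + i)%N (tnth t i))
      * (1 + B) ^+ later_count e t <= (1 + B * (N%:R * eps)) ^+ n.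
Proof.
(* The offset [j] varies because removing the head shifts the laws [q]; the fixed [N] keeps the
   factor gained at each step the same. *)
move=> B0 eps0 q0 q1 qe; elim=> [_ j|n IH nN j].
  rewrite (bigD1 [tuple])//= [X in _ + X]big1 ?addr0.
    by rewrite big_ord0 mulr1 expr0.
  by move=> t /eqP[]; exact: tuple0.
have x0 : 0 <= 1 + B * (N%:R * eps) by rewrite addr_ge0// !mulr_ge0.
rewrite big_tuple_cons.
pose W (t : n.-tuple T) := (\prod_(i < n) q (j.+1 + i)%N (tnth t i))
  * (1 + B) ^+ later_count e t.
have W0 t : 0 <= W t.
  by rewrite mulr_ge0 ?exprn_ge0 ?addr_ge0//; apply: prodr_ge0.
apply: (@le_trans _ _ (\sum_t (1 + B * (N%:R * eps)) * W t)); last first.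
  rewrite -mulr_sumr exprS ler_wpM2l//; apply: IH; exact: ltnW.
apply: ler_sum => t _.
rewrite (eq_bigr (fun c => (q j c * (1 + B) ^+ has (e c) t) * W t)); last first.
  move=> c _; rewrite (prod_tuple_cons n (fun i => q (j + i)%N)) addn0/= exprD.
  rewrite /W (eq_bigr (fun i : 'I_n => q (j.+1 + i)%N (tnth t i))).
    by rewrite mulrACA.
  by move=> i _; rewrite /bump/= add1n addSnnS.
rewrite -mulr_suml ler_wpM2r//.
(* For a bit [b], [(1 + B) ^+ b] is [1 + B * b]; the bit [has] is then bounded by a sum over the
   later entries. *)
apply: (@le_trans _ _ (\sum_c (q j c + B * \sum_(i < n) (if e c (tnth t i) then q j c else 0)))).
  apply: ler_sum => c _; case/boolP: (has _ _) => [/hasP[c' /tnthP[i ->] ei]|_].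
    rewrite expr1 mulrDr mulr1 lerD2l mulrC ler_wpM2l//.
    rewrite (bigD1 i)//= ei lerDl sumr_ge0// => i' _; by case: ifP.
  rewrite expr0 mulr1 lerDl mulr_ge0// sumr_ge0// => i' _; by case: ifP.
rewrite big_split/= lerD// -mulr_sumr ler_wpM2l// exchange_big/=.
apply: (@le_trans _ _ (\sum_(i < n) eps)).
  by apply: ler_sum => i _; rewrite -big_mkcond.
by rewrite sumr_const card_ord -[leLHS]mulr_natl ler_wpM2r// ler_nat ltnW.
Qed.

End tuple_sums.

(** * Monotone integrals and finite unions *)

Section measure_lemmas.
Local Open Scope ereal_scope.
Context {disp : measure_display} {T : measurableType disp} {R : realType}.

(* Measurable or not, the integral of a nonnegative function is the supremum of
   the integrals of the simple functions below it. *)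
Lemma ge0_le_integralT (mu : {measure set T -> \bar R}) (f g : T -> \bar R) :
  (forall x, 0 <= f x) -> (forall x, f x <= g x) ->
  \int[mu]_x f x <= \int[mu]_x g x.
Proof.
move=> f0 fg; have g0 x : 0 <= g x by exact: le_trans (f0 x) (fg x).
rewrite !ge0_integralTE//; apply: ereal_sup_le => _ [h hf <-].
by exists h => // x; exact: le_trans (hf x) (fg x).
Qed.

Lemma measure_bigsetU_le (mu : {measure set T -> \bar R}) (I : Type)
    (r : seq I) (Q : pred I) (F : I -> set T) :
  (forall i, measurable (F i)) ->
  mu (\big[setU/set0]_(i <- r | Q i) F i) <= \sum_(i <- r | Q i) mu (F i).
Proof.
move=> mF; elim: r => [|i r IH]; first by rewrite !big_nil measure0.
rewrite !big_cons; case: ifP => // _.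
apply: le_trans (measureU2 _ _ _) _ => //; first exact: bigsetU_measurable.
exact: leeD2l.
Qed.

Lemma sum_measure_disjoint_le (mu : {measure set T -> \bar R}) (I : finType)
    (F : I -> set T) :
  (forall i, measurable (F i)) -> trivIset setT F ->
  \sum_i mu (F i) <= mu setT.
Proof.
move=> mF tF; apply: (@le_trans _ _ (mu (\bigcup_(i in [set: I]) F i))).
  rewrite measure_fin_bigcup//; last exact: finite_finset.
  rewrite (fsbigE (index_enum I)) ?index_enum_uniq//=.
    by rewrite le_eqVlt; apply/orP; left; apply/eqP/eq_bigl => i; rewrite in_setT.
  by move=> i _; rewrite mem_index_enum.
by rewrite le_measure ?inE//; apply: fin_bigcup_measurable => //; exact: finite_finset.
Qed.

End measure_lemmas.

(** * Grid cells as measurable boxes *)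

Section tuple_boxes.
Context {R : realType} {d : nat}.

Lemma measurable_tuple_box (A : 'I_d -> set R) :
  (forall k, measurable (A k)) ->
  measurable [set x : d.-tuple R | forall k, A k (tnth x k)].
Proof.
move=> mA; rewrite (_ : [set x | _] =
    \bigcap_(k in [set: 'I_d]) ((@tnth d R ^~ k) @^-1` A k)).
  apply: fin_bigcap_measurable => // k _.
  by rewrite -[X in measurable X]setTI; exact: measurable_tnth.
by apply/seteqP; split => t /= H k; [move=> _|]; exact: H.
Qed.

Lemma measurable_unit_cube : measurable (unit_cube R d).
Proof.
rewrite (_ : unit_cube R d = [set x | forall k, `[0, 1]%classic (tnth x k)]).
  by apply: (measurable_tuple_box (fun=> `[0, 1]%classic)) => k; exact: measurable_itv.
by apply/seteqP; split => x /= H k; have := H k; rewrite in_itv.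
Qed.

(** Half-open sides make the boxes disjoint. Boxes with an index [m] start at the boundary of the
    cube and catch coordinates equal to 1. *)
Definition grid_box m (c : {ffun 'I_d -> 'I_m.+1}) : set (d.-tuple R) :=
  [set x | forall k,
     `[(c k)%:R / m%:R, (c k).+1%:R / m%:R[%classic (tnth x k)].

Lemma measurable_grid_box m c : measurable (grid_box m c).
Proof.
apply: (measurable_tuple_box
  (fun k => `[(c k)%:R / m%:R, (c k).+1%:R / m%:R[%classic)) => k.
exact: measurable_itv.
Qed.

Lemma grid_box_itv m c x k : (0 < m)%N -> grid_box m c x ->
  (c k)%:R <= m%:R * tnth x k < (c k).+1%:R.
Proof.
move=> m0 /(_ k) /=; rewrite in_itv/= => /andP[].
by rewrite ler_pdivrMr ?ltr0n// ltr_pdivlMr ?ltr0n// mulrC => -> ->.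
Qed.

(** Truncating [m%:R * tnth x k] recovers the index of the box from any of its points. *)
Lemma grid_box_disjoint m : (0 < m)%N -> trivIset setT (grid_box m).
Proof.
move=> m0; apply/trivIsetP => c c' _ _ cc'; apply/seteqP; split => // x [].
move=> Hc Hc'; case/eqP: cc'; apply/ffunP => k; apply: val_inj => /=.
have := truncn_def (grid_box_itv _ _ _ k m0 Hc).
by have := truncn_def (grid_box_itv _ _ _ k m0 Hc') => -> ->.
Qed.

Lemma grid_cell_box m x : (0 < m)%N -> unit_cube R d x ->
  grid_box m (grid_cell m x) x.
Proof.
move=> m0 Cx k /=; have /andP[a b] := grid_cell_itv m _ k Cx.
by rewrite in_itv/= ler_pdivrMr ?ltr0n// ltr_pdivlMr ?ltr0n// mulrC a.
Qed.

Lemma lebesgue_grid_box m c : (0 < m)%N ->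
  lebesgue_tuple R d (grid_box m c) = ((m%:R^-1) ^+ d)%:E.
Proof.
move=> m0; rewrite /grid_box (@lebesgue_tuple_box R d
  (fun k => `[(c k)%:R / m%:R, (c k).+1%:R / m%:R[%classic)); last first.
  by move=> k; exact: measurable_itv.
rewrite (eq_bigr (fun=> (m%:R^-1)%:E)).
  by rewrite prodEFin prodr_const card_ord.
move=> k _; rewrite lebesgue_measure_itv/= lte_fin.
rewrite ltr_pM2r ?invr_gt0 ?ltr0n// ltr_nat ltnSn -EFinB -mulrBl.
by rewrite -natr1 addrAC subrr add0r mul1r.
Qed.

End tuple_boxes.

(** * The exceptional event and its probability *)

Section perturbed.
Context {R : realType} {disp : measure_display} {Omega : measurableType disp}.
Context {P : probability Omega R} {phi : R} {d n : nat}.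
Context {f : 'I_n -> d.-tuple R -> R} {X : 'I_n -> {RV P >-> d.-tuple R}}.
Hypothesis inst : perturbed_instance phi f X.
Hypothesis phi_ge0 : 0 <= phi.

Lemma measurable_RV_preimage i (A : set (d.-tuple R)) :
  measurable A -> measurable (X i @^-1` A).
Proof.
by move=> mA; rewrite -[X in measurable X]setTI; exact: measurable_funP.
Qed.

Lemma prob_outside_cube i : P (X i @^-1` ~` unit_cube R d) = 0%E.
Proof.
have [_ _ dens _] := inst; rewrite dens.
  by rewrite setICl integral_set0.
by apply: measurableC; exact: measurable_unit_cube.
Qed.

Lemma prob_grid_box_le m c i : (0 < m)%N ->
  (P (X i @^-1` grid_box m c) <= (phi / m%:R ^+ d)%:E)%E.
Proof.
move=> m0; have [mf fphi dens _] := inst.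
have mB := @measurable_grid_box R d m c.
have mC := @measurable_unit_cube R d.
have mBC : measurable (grid_box m c `&` unit_cube R d) by exact: measurableI.
rewrite dens//.
apply: (@le_trans _ _ (\int[lebesgue_tuple R d]_(x in grid_box m c `&` unit_cube R d)
    (cst phi%:E) x)%E).
  apply: ge0_le_integral => //.
  - by move=> x [_ Cx]; rewrite lee_fin; have /andP[] := fphi i x Cx.
  - by apply/measurable_EFinP; apply: measurable_funS (mf i).
  - by move=> x [_ Cx]; rewrite lee_fin; have /andP[] := fphi i x Cx.
rewrite integral_cst// EFinM lee_wpmul2l ?lee_fin//.
rewrite -exprVn -(lebesgue_grid_box m c m0).
by rewrite le_measure ?inE// => x [].
Qed.

(** The laws are extended by 0 to all natural indices, the form [moment_later_count] expects; its
    conditions survive because they are upper bounds. *)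
Definition cell_prob m (j : nat) (c : {ffun 'I_d -> 'I_m.+1}) : R :=
  if (insub j : option 'I_n) is Some i then fine (P (X i @^-1` grid_box m c))
  else 0.

Lemma cell_prob_ord m (i : 'I_n) c :
  (cell_prob m i c)%:E = P (X i @^-1` grid_box m c).
Proof.
rewrite /cell_prob valK fineK// fin_num_measure//.
by apply: measurable_RV_preimage; exact: measurable_grid_box.
Qed.

Lemma cell_prob_ge0 m j c : 0 <= cell_prob m j c.
Proof. by rewrite /cell_prob; case: insubP => // i _ _; exact: fine_ge0. Qed.

Lemma cell_prob_out m j c : (n <= j)%N -> cell_prob m j c = 0.
Proof. by move=> nj; rewrite /cell_prob insubF// ltnNge nj. Qed.

Lemma cell_prob_le m j c : (0 < m)%N -> cell_prob m j c <= phi / m%:R ^+ d.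
Proof.
move=> m0; have [nj|jn] := leqP n j.
  by rewrite cell_prob_out// divr_ge0// exprn_ge0.
by rewrite -lee_fin (cell_prob_ord m (Ordinal jn)) prob_grid_box_le.
Qed.

Lemma sum_cell_prob_le1 m j : (0 < m)%N -> \sum_c cell_prob m j c <= 1.
Proof.
move=> m0; have [nj|jn] := leqP n j.
  by rewrite big1// => c _; rewrite cell_prob_out.
rewrite -lee_fin -sumEFin.
under eq_bigr do rewrite (cell_prob_ord m (Ordinal jn)).
rewrite -(probability_setT P); apply: sum_measure_disjoint_le => [c|].
  by apply: measurable_RV_preimage; exact: measurable_grid_box.
apply/trivIsetP => c c' _ _ cc'.
have /trivIsetP disj := @grid_box_disjoint R d m m0.
by rewrite -preimage_setI disj// preimage_set0.
Qed.

Lemma sum_near_cell_prob_le m j c' : (0 < m)%N ->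
  \sum_(c | near_cells 1 c c') cell_prob m j c <= 3 ^+ d * (phi / m%:R ^+ d).
Proof.
move=> m0; apply: le_trans (ler_sum _ (fun c _ => cell_prob_le m j c m0)) _.
rewrite sumr_const -[leLHS]mulr_natl ler_wpM2r ?divr_ge0 ?exprn_ge0//.
rewrite -natrX ler_nat -cardsE.
rewrite (_ : finset _ = [set c | near_cells 1 c' c]%SET).
  exact: (card_near_cells m 1 c').
by apply/setP => c; rewrite !inE near_cells_sym.
Qed.

Definition crowded m (t : n.-tuple {ffun 'I_d -> 'I_m.+1}) : bool :=
  (n <= 4 * later_count (near_cells 1) t)%N.

(** The intersection is indexed by a finite set so that [mutually_independent] applies directly. *)
Definition cells_event m (t : n.-tuple {ffun 'I_d -> 'I_m.+1}) : set Omega :=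
  \bigcap_(i in [set` [set: 'I_n]%SET]) (X i @^-1` grid_box m (tnth t i)).

(** A finite union of preimages of boxes is visibly measurable. The first part, a vertex outside the
    cube, has probability 0. *)
Definition bad_event m : set Omega :=
  \big[setU/set0]_(i < n) (X i @^-1` ~` unit_cube R d) `|`
  \big[setU/set0]_(t | crowded m t) cells_event m t.

Lemma measurable_cells_event m t : measurable (cells_event m t).
Proof.
apply: fin_bigcap_measurable => // i _.
by apply: measurable_RV_preimage; exact: measurable_grid_box.
Qed.

Lemma measurable_bad_event m : measurable (bad_event m).
Proof.
apply: measurableU; apply: bigsetU_measurable => ? _.
  by apply/measurable_RV_preimage/measurableC; exact: measurable_unit_cube.
exact: measurable_cells_event.
Qed.

Lemma prob_cells_event m t :
  P (cells_event m t) = (\prod_(i < n) cell_prob m i (tnth t i))%:E.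
Proof.
have [_ _ _ ind] := inst.
rewrite /cells_event (ind [set: 'I_n]%SET (fun i => grid_box m (tnth t i))).
  rewrite -prodEFin; apply: eq_big => [i|i _]; first by rewrite finset.in_setT.
  by rewrite cell_prob_ord.
by move=> i; exact: measurable_grid_box.
Qed.

(** Markov's inequality for 256 to the power [later_count]: its mean is at most [2 ^ n], while a
    crowded tuple makes it at least [4 ^ n]. *)
Lemma prob_bad_event_le m : (0 < m)%N ->
  n%:R * (3 ^+ d * phi) * 256 <= m%:R ^+ d ->
  (P (bad_event m) <= ((2^-1) ^+ n)%:E)%E.
Proof.
move=> m0 nm; have md0 : 0 < m%:R ^+ d :> R by rewrite exprn_gt0// ltr0n.
apply: (le_trans (measureU2 _ _ _)) => /=.
- apply: bigsetU_measurable => i _.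
  by apply/measurable_RV_preimage/measurableC; exact: measurable_unit_cube.
- by apply: bigsetU_measurable => t _; exact: measurable_cells_event.
rewrite -[leRHS]add0e; apply: leeD.
  apply: le_trans (measure_bigsetU_le _ _ _ _ _ _) _.
    move=> i; apply/measurable_RV_preimage/measurableC.
    exact: measurable_unit_cube.
  by rewrite big1// => i _; exact: prob_outside_cube.
apply: le_trans (measure_bigsetU_le _ _ _ _ _ (measurable_cells_event m)) _.
rewrite (eq_bigr _ (fun t _ => prob_cells_event m t)) sumEFin lee_fin.
pose eps : R := 3 ^+ d * (phi / m%:R ^+ d).
have eps0 : 0 <= eps by rewrite mulr_ge0 ?divr_ge0 ?exprn_ge0.
(* The value 255 makes [1 + B] equal to [4 ^ 4], matching the factor 4 in [crowded]. *)
have := @moment_later_count R {ffun 'I_d -> 'I_m.+1} (near_cells 1) (cell_prob m)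
  255 eps n (ler0n R 255) eps0 (cell_prob_ge0 m) (fun j => sum_cell_prob_le1 m j m0)
  (fun j c => sum_near_cell_prob_le m j c m0) n (leqnn n) 0%N.
have : (1 + 255 * (n%:R * eps)) ^+ n <= 2 ^+ n.
  apply: lerXn2r; rewrite ?nnegrE ?addr_ge0 ?mulr_ge0//.
  have : n%:R * eps * 256 <= 1.
    rewrite (_ : _ * 256 = n%:R * (3 ^+ d * phi) * 256 / m%:R ^+ d).
      by rewrite ler_pdivrMr// mul1r.
    by rewrite /eps; ring.
  have : 0 <= n%:R * eps by rewrite mulr_ge0.
  by lra.
move=> /[swap]/le_trans/[apply] M.
have q0 t : 0 <= \prod_(i < n) cell_prob m i (tnth t i).
  by apply: prodr_ge0 => i _; exact: cell_prob_ge0.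
rewrite (_ : 2^-1 = 2 / 4 :> R); last by field.
rewrite expr_div_n ler_pdivlMr ?exprn_gt0//; apply: le_trans M.
rewrite mulr_suml big_mkcond/=; apply: ler_sum => t _.
have -> : 1 + 255 = 4 ^+ 4 :> R by ring.
case: ifP => [ct|_]; last by rewrite mulr_ge0 ?exprn_ge0.
by rewrite ler_wpM2l// -exprM ler_weXn2l// ler1n.
Qed.

Lemma good_event m w : (0 < m)%N -> ~ bad_event m w ->
  (forall i, unit_cube R d (X i w)) /\
  (4 * later_count (near_cells 1) [tuple grid_cell m (X i w) | i < n] < n)%N.
Proof.
move=> m0 /not_orP[nout ncr].
have Cw i : unit_cube R d (X i w).
  apply: contrapT => nC; apply: nout.
  by rewrite (bigD1 i)//=; left.
split => //; rewrite ltnNge; apply/negP => cr; apply: ncr.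
rewrite (bigD1 [tuple grid_cell m (X i w) | i < n])//=; left.
by move=> i _ /=; rewrite tnth_mktuple; exact: grid_cell_box.
Qed.

End perturbed.

(** * Assembling the expected ratio *)

Lemma expectation_le_off_event {R : realType} {disp : measure_display}
    {Omega : measurableType disp} (P : probability Omega R) (Y : Omega -> R)
    (B : set Omega) (G T e : R) :
  measurable B -> 0 <= G -> 0 <= T -> (forall w, 0 <= Y w) ->
  (forall w, Y w <= T) -> (forall w, ~ B w -> Y w <= G) ->
  (P B <= e%:E)%E -> ('E_P[Y] <= (G + T * e)%:E)%E.
Proof.
move=> mB G0 T0 Y0 YT YG PB; rewrite unlock.
(* [Y] is dominated pointwise by a measurable function whose integral is [G + T * P B]. *)
apply: (@le_trans _ _ (\int[P]_w (G%:E + T%:E * (\1_B w)%:E))%E).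
  apply: ge0_le_integralT => w; first by rewrite lee_fin.
  rewrite -EFinM -EFinD lee_fin indicE.
  have [Bw|nBw] := pselect (B w).
    by rewrite mem_set// mulr1 (le_trans (YT w))// lerDr.
  by rewrite memNset// mulr0 addr0 YG.
have mI : measurable_fun [set: Omega] (fun w => (\1_B w : R)%:E).
  by apply/measurable_EFinP; exact: measurable_indic.
rewrite ge0_integralD//; last 2 first.
- by move=> w _; rewrite -EFinM lee_fin mulr_ge0.
- exact: measurable_funeM.
rewrite integral_cst// ge0_integralZl_EFin// integral_indic// setIT.
by rewrite [X in (_ * X + _)%E]probability_setT mule1 EFinD EFinM leeD2l// lee_wpmul2l.
Qed.

(** The factor 2 covers [n = 3], the only case where the square exceeds the power; from 3 on the
    square at most doubles. *)
Lemma sqr_le_exp2 n : (n ^ 2 <= 2 * 2 ^ n)%N.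
Proof.
do 3 (case: n => [//|n]).
elim: n => // n; rewrite (expnS 2 n.+3) -!mulnn.
by move: (2 ^ n.+3)%N => x; nia.
Qed.

Theorem theorem4 (R : realType) (d : nat) (p : Lp_index) :
  (2 <= d)%N -> Lp_valid p ->
  exists2 C : R, 0 < C &
    forall (phi : R) (n : nat) (disp : measure_display)
           (Omega : measurableType disp) (P : probability Omega R)
           (f : 'I_n -> d.-tuple R -> R) (X : 'I_n -> {RV P >-> d.-tuple R}),
      1 <= phi ->
      perturbed_instance phi f X ->
      ('E_P[fun w => worst_two_opt_ratio p (fun i => X i w)]
         <= (C * phi `^ (d%:R^-1))%:E)%E.
Proof.
move=> d2 pv; have d0 : (0 < d)%N by exact: ltnW.
pose U : R := (d + 4 * d * (2 * d.*2.*2.+1) ^ d)%:R.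
have U0 : 0 <= U by rewrite ler0n.
have UE : U = (d + 4 * d * (2 * d.*2.*2.+1) ^ d)%:R by [].
clearbody U.
(* The first summand covers the good event, with [Q <= 1537 * rt]; the second covers both [n <= 2]
   and the exceptional event. *)
exists (2 * (U * 1537) + 4 * d%:R).
  have dR : 0 < d%:R :> R by rewrite ltr0n.
  by lra.
move=> phi n disp Omega P f X phi1 inst.
have phi0 : 0 <= phi by lra.
set rt := phi `^ d%:R^-1.
have rt1 : 1 <= rt.
  by rewrite -(powRr0 phi) ler_powR// invr_ge0.
have rtd : rt ^+ d = phi.
  by rewrite -powR_mulrn ?powR_ge0// -powRrM mulVf ?powRr1// pnatr_eq0 -lt0n.
have dn0 : 0 <= d%:R * n%:R ^+ 2 :> R by rewrite mulr_ge0// exprn_ge0.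
have trivial w : worst_two_opt_ratio p (fun i => X i w) <= d%:R * n%:R ^+ 2.
  exact: worst_two_opt_ratio_trivial.
(* With at most two vertices the a priori bound is already [4 * d]; the exceptional event is taken
   empty. *)
have [n2|n2] := leqP n 2.
  apply: (@le_trans _ _ (4 * d%:R + 4 * d%:R * 0)%:E); last first.
    rewrite lee_fin mulr0 addr0; apply: (@le_trans _ _ (4 * d%:R * rt)).
      by rewrite ler_peMr// mulr_ge0.
    by rewrite ler_wpM2r ?(le_trans _ rt1)//; lra.
  have d4 : d%:R * n%:R ^+ 2 <= 4 * d%:R :> R.
    rewrite mulrC ler_wpM2r// -natrX ler_nat.
    by rewrite (@leq_exp2r n 2 2).
  apply: (expectation_le_off_event P _ set0); rewrite ?measure0 ?mulr_ge0//.
  - by move=> w; exact: worst_two_opt_ratio_ge0.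
  - by move=> w; exact: le_trans (trivial w) d4.
  - by move=> w _; exact: le_trans (trivial w) d4.
(* The finest cells of the upper bound have side [1 / 2 ^ K], of order
   [n ^ (-1/d)]; those of the lower bound are finer by the factor [Q], of order
   [phi ^ (1/d)]. *)
pose K := trunc_log (2 ^ d) n.
have d21 : (1 < 2 ^ d)%N by rewrite -{1}(expn0 2) ltn_exp2l.
have Kn : (2 ^ (d * K) <= n)%N by rewrite expnM trunc_logP// (ltn_trans _ n2).
have nK : (n <= 2 ^ (d * K.+1))%N by rewrite expnM ltnW// trunc_log_ltn.
pose Q := (Num.trunc (1536 * rt)).+1.
have Q_ge : 1536 * rt <= Q%:R by rewrite ltW// truncnS_gt.
have Q_le : Q%:R <= 1537 * rt.
  have : (Num.trunc (1536 * rt))%:R <= 1536 * rt by rewrite truncn_le; lra.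
  by rewrite /Q -natr1; lra.
pose m := (2 ^ K * Q)%N.
have m0 : (0 < m)%N by rewrite muln_gt0 expn_gt0.
have fine_grid : n%:R * (3 ^+ d * phi) * 256 <= m%:R ^+ d.
  apply: (@le_trans _ _ (2 ^+ (d * K) * (1536 * rt) ^+ d)); last first.
    rewrite /m natrM natrX [leRHS]exprMn -exprM (mulnC K) ler_wpM2l ?exprn_ge0//.
    by apply: lerXn2r; rewrite ?nnegrE; lra.
  (* After raising to the power [d], 2 pays for [n <= 2 ^ (d * K.+1)], 3 for the near cells, 256 for
     the moment bound and [rt] for [phi]. *)
  rewrite (_ : 1536 * rt = 2 * 3 * 256 * rt); last by lra.
  rewrite !exprMn rtd.
  have a1 : n%:R <= 2 ^+ (d * K) * 2 ^+ d :> R.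
    by rewrite -exprD -natrX ler_nat -mulnSr.
  have a2 : 256 <= 256 ^+ d :> R by rewrite -{1}(expr1 256) ler_weXn2l ?ler1n.
  rewrite (_ : 2 ^+ (d * K) * _ =
    (2 ^+ (d * K) * 2 ^+ d) * (3 ^+ d * phi) * 256 ^+ d); last by ring.
  apply: ler_pM => //; first by rewrite !mulr_ge0 ?exprn_ge0.
  by rewrite ler_wpM2r// mulr_ge0// exprn_ge0.
apply: (@le_trans _ _ (2 * U * Q%:R + d%:R * n%:R ^+ 2 * 2^-1 ^+ n)%:E).
  apply: (expectation_le_off_event P _ (bad_event m)) => //.
  - exact: measurable_bad_event.
  - by rewrite !mulr_ge0.
  - by move=> w; exact: worst_two_opt_ratio_ge0.
  - move=> w /(good_event _ _ m0)[Cw few].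
    apply: worst_two_opt_ratio_le => [|s s' opts]; first by rewrite !mulr_ge0.
    have up := two_opt_tour_length_le p _ s K pv Cw n2 d2 opts Kn.
    rewrite -UE in up.
    have low := tour_length_ge p _ s' m pv Cw n2 few.
    rewrite -(@ler_pM2l _ (2 ^+ K)) ?exprn_gt0//; apply: le_trans up _.
    (* Both bounds are linear in [n], which cancels; since [m = 2 ^ K * Q], only [2 * U * Q] is left
       as ratio. *)
    apply: le_trans (ler_wpM2l U0 low) _.
    rewrite /m natrM natrX.
    by rewrite le_eqVlt; apply/orP; left; apply/eqP; ring.
  - exact: (prob_bad_event_le inst phi0).
rewrite lee_fin -/rt [leRHS]mulrDl; apply: lerD.
  by rewrite -!mulrA ler_wpM2l// ler_wpM2l.
(* The probability [2 ^ -n] outweighs the quadratic a priori bound. *)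
apply: (@le_trans _ _ (2 * d%:R)).
  rewrite exprVn ler_pdivrMr ?exprn_gt0// mulrC.
  rewrite [leRHS](_ : _ = (2 * 2 ^+ n) * d%:R); last by ring.
  rewrite ler_wpM2r//.
  by have := sqr_le_exp2 n; rewrite -(ler_nat R) natrM !natrX.
apply: (@le_trans _ _ (4 * d%:R)); first by rewrite ler_wpM2r// ler_nat.
by rewrite ler_peMr// mulr_ge0.
Qed.
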